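(* Let ${\bf E}$ be the real $n$-dimensional evolution algebra with natural basis $\{{\bf e}_i\}_{i=1}^n$ and structural matrix $A=(a_{i,j})$ in normal form, let $\mathcal I_A=\{(i,j): i+1<j<n,\ a_{i,j}\neq 0\}$, and let $f(x)=\frac{x^2}{2x+1}$. Then the following hold. (i) If $\mathcal I_A=\emptyset$, then $\mathcal{RB}_1^{\vartriangle}({\bf E})$ is exactly the set of linear operators $R$ of the form $$R({\bf e}_1)=\alpha{\bf e}_1+\beta{\bf e}_n,\qquad R({\bf e}_i)=f^{i-1}(\alpha){\bf e}_i\ \ (1<i\le n),$$ with $\alpha,\beta\in\mathbb R$, $\alpha\neq-\frac12$. (ii) If $\mathcal I_A\neq\emptyset$, then $\mathcal{RB}_1^{\vartriangle}({\bf E})$ is exactly the set of linear operators $R$ of the form $$R({\bf e}_1)=\alpha{\bf e}_1+\beta{\bf e}_n,\qquad R({\bf e}_i)=\alpha{\bf e}_i\ \ (1<i\le n),$$ with $\alpha\in\{-1,0\}$, $\beta\in\mathbb R$.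
   Context: The evolution algebra with natural basis $\{{\bf e}_i\}_{i=1}^n$ and structural matrix $A=(a_{i,j})$ is the algebra with bilinear multiplication ${\bf e}_i{\bf e}_j={\bf 0}$ for $i\neq j$ and ${\bf e}_i^2=\sum_{j}a_{i,j}{\bf e}_j$. ''Normal form'' means $A$ is strictly upper triangular ($a_{i,j}=0$ for $j\le i$), $a_{i,i+1}=1$ for all $i<n$, and $a_{i,n}=0$ for all $i\le n-2$; the remaining entries $a_{i,j}\in\mathbb R$ ($i+1<j<n$) are arbitrary. A linear map $R:{\bf E}\to{\bf E}$ is a Rota-Baxter operator of weight $1$ if $R({\bf x})R({\bf y})=R(R({\bf x}){\bf y}+{\bf x}R({\bf y})+{\bf x}{\bf y})$ for all ${\bf x},{\bf y}\in{\bf E}$. Write $R({\bf e}_i)=\sum_{k}r_{i,k}{\bf e}_k$ (every such $R$ has $r_{i,k}=0$ for $k<i$). $\mathcal{RB}_1^{\vartriangle}({\bf E})$ is the set of Rota-Baxter operators $R$ of weight $1$ on ${\bf E}$ with $r_{i,j}=0$ for all $i<j<n$. $f^k$ denotes the $k$-fold composition of $f$. *)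

(* Defs.v *)
From HB Require Import structures.
From mathcomp Require Import all_boot all_order all_algebra.
From mathcomp Require Import boolp classical_sets reals.

Set Implicit Arguments.
Unset Strict Implicit.
Unset Printing Implicit Defensive.

Import Order.TTheory GRing.Theory Num.Theory.

Local Open Scope ring_scope.

(* Indices are shifted by one: for dimension n.+1 the basis vectors           *)
(* e_1, ..., e_(n.+1) are e`_0, ..., e`_n.                                    *)

Definition is_evolution_algebra (K : fieldType) (E : vectType K) (n : nat)
    (mul : {bilinear E -> E -> E}) (e : n.-tuple E) (A : 'M[K]_n) : Prop :=
  [/\ basis_of fullv e,
      forall i j : 'I_n, i != j -> mul e`_i e`_j = 0
    & forall i : 'I_n, mul e`_i e`_i = \sum_j A i j *: e`_j].

Definition normal_form (K : fieldType) (n : nat) (A : 'M[K]_n.+1) : Prop :=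
  [/\ forall i j : 'I_n.+1, (j <= i)%N -> A i j = 0,
      forall i j : 'I_n.+1, j = i.+1 :> nat -> A i j = 1
    & forall i : 'I_n.+1, (i.+1 < n)%N -> A i ord_max = 0].

Definition I_set (K : fieldType) (n : nat) (A : 'M[K]_n.+1)
    : {set 'I_n.+1 * 'I_n.+1} :=
  [set p : 'I_n.+1 * 'I_n.+1 |
    [&& (p.1.+1 < p.2)%N, (p.2 < n)%N & A p.1 p.2 != 0]]%SET.

Definition rota_baxter1 (K : fieldType) (E : vectType K)
    (mul : {bilinear E -> E -> E}) (R : 'End(E)) : Prop :=
  forall x y : E, mul (R x) (R y) = R (mul (R x) y + mul x (R y) + mul x y).

(* The coefficient r_(i,j) of R is coord e j (R e`_i). *)
Definition RB1_tri (K : fieldType) (E : vectType K) (n : nat)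
    (mul : {bilinear E -> E -> E}) (e : n.+1.-tuple E) : set 'End(E) :=
  [set R : 'End(E) | rota_baxter1 mul R /\
    forall i j : 'I_n.+1, (i < j < n)%N -> coord e j (R e`_i) = 0]%classic.

Definition rb_map (K : fieldType) (x : K) : K := x ^+ 2 / (2%:R * x + 1).

(* Main.v *)
Require Import Defs.
From HB Require Import structures.
From mathcomp Require Import all_boot all_order all_algebra.
From mathcomp Require Import boolp classical_sets reals.
From mathcomp Require Import ring lra zify.

(** Count indices from [0] to [n] and write [C i j] for the coefficients of [R]
    in the natural basis. Testing the Rota-Baxter identity on the pair
    [(e_i, e_i)] gives the quadratic system
    [\sum_k C i k ^+ 2 * A k j = (2 * C i i + 1) * \sum_k A i k * C k j]
    ([square_system]), and every constraint on [R] comes out of it.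

    - [C] is upper triangular ([square_system_triangular]): in column [k + 1],
      the first coefficient [C i k] to the left of the diagonal contributes its
      square alone, since [A] has ones just above the diagonal, while the
      right-hand side only sees lower rows, triangular by descending induction.
    - If moreover [C] vanishes strictly between the diagonal and the last
      column, the entry [j = i + 1] shows [2 * C i i + 1 != 0]. The last column
      of [A] is almost zero, so the last column of [C] solves a homogeneous
      triangular system, which kills it strictly between its two ends
      ([square_system_last_column]).

    What remains is a diagonal [r], one free coefficient [beta], and the
    relation [r_i ^ 2 = (2 r_i + 1) r_j] for each [a_(i,j) != 0]
    ([diagonal_relations]). Conversely these data define an operator of the
    class, because [e_n ^ 2 = 0] makes [beta] invisible to products
    ([RB1_triP]).

    The superdiagonal of [A] turns the relations into [r_(i+1) = f r_i], so
    [r] is the orbit of [r_0] under [f]; when [I_A] is empty there is nothing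
    else, and the orbit never meets the pole since [f x = -1/2] would mean
    [x ^ 2 + (x + 1) ^ 2 = 0]. An element [(i, j)] of [I_A] forces in addition
    [r_(i+1) = r_j] with [i + 1 < j], a period of the orbit. But
    [q x = x (x + 1)] satisfies [q (f x) = q x ^ 2 / (1 + 4 q x)]: it is
    nonnegative along the orbit from the first step on and strictly decreasing
    while nonzero. Hence [q] vanishes at a periodic point, then everywhere on
    the orbit, and the zeros of [q], namely [0] and [-1], are exactly the fixed
    points of [f]. *)

Set Implicit Arguments.
Unset Strict Implicit.
Unset Printing Implicit Defensive.

Import Order.TTheory GRing.Theory Num.Theory.

Local Open Scope ring_scope.

(** * The dynamics of the map x ^ 2 / (2 x + 1) *)

Lemma rb_map_unique (K : fieldType) (x y : K) :
  x ^+ 2 = (2%:R * x + 1) * y -> 2%:R * x + 1 != 0 /\ y = rb_map x.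
Proof.
move=> xy; have x0 : 2%:R * x + 1 != 0.
  apply/eqP => x0; move/eqP: xy; rewrite x0 mul0r sqrf_eq0 => /eqP xE.
  by move/eqP: x0; rewrite xE mulr0 add0r oner_eq0.
by split=> //; rewrite /rb_map xy mulrAC mulfV ?mul1r.
Qed.

Lemma rb_map_fixed (K : fieldType) (x : K) :
  x = -1 \/ x = 0 -> rb_map x = x.
Proof.
case=> ->; rewrite /rb_map; last by rewrite expr0n mul0r.
have -> : 2%:R * -1 + 1 = -1 :> K by ring.
by rewrite sqrrN expr1n invrN1 mul1r.
Qed.

Lemma iter_rb_map_pole_free (K : realFieldType) (x : K) (k : nat) :
  2%:R * x + 1 != 0 -> 2%:R * iter k (@rb_map K) x + 1 != 0.
Proof.
move=> x0; elim: k => //= k; set y := iter k _ x => y0; apply/eqP.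
have : rb_map y * (2%:R * y + 1) = y ^+ 2 by rewrite /rb_map mulfVK.
move: (rb_map y) => z zE z0.
have {z0} zV : z = - 2%:R^-1 by lra.
move: zE y0; rewrite zV => yE y0.
have : 0 < y ^+ 2 + (y + 1) ^+ 2 by nra.
by rewrite lt_neqAle => /andP[/eqP[]]; nra.
Qed.

Definition rb_potential (K : fieldType) (x : K) : K := x * (x + 1).

Lemma rb_potential_eq0 (K : fieldType) (x : K) :
  rb_potential x = 0 -> x = -1 \/ x = 0.
Proof.
move/eqP; rewrite mulf_eq0 addr_eq0 => /orP[/eqP->|/eqP->]; by [right|left].
Qed.

(** The factor [1 + 4 q x] is the square of the denominator [2 x + 1], which is
    what makes [q] a good coordinate for the map. *)
Lemma rb_potential_map (K : fieldType) (x : K) : 2%:R * x + 1 != 0 ->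
  rb_potential (rb_map x) * (1 + 4%:R * rb_potential x) = rb_potential x ^+ 2.
Proof. by move=> x0; rewrite /rb_potential /rb_map; field. Qed.

Lemma rb_potential_denom_gt0 (K : realFieldType) (x : K) : 2%:R * x + 1 != 0 ->
  0 < 1 + 4%:R * rb_potential x.
Proof.
move=> x0; have -> : 1 + 4%:R * rb_potential x = (2%:R * x + 1) ^+ 2.
  by rewrite /rb_potential; ring.
by rewrite exprn_even_gt0.
Qed.

Lemma rb_potential_map_ge0 (K : realFieldType) (x : K) :
  2%:R * x + 1 != 0 -> 0 <= rb_potential (rb_map x).
Proof.
move=> x0; have d0 := rb_potential_denom_gt0 x0.
by rewrite -(pmulr_lge0 _ d0) rb_potential_map ?sqr_ge0.
Qed.

Lemma rb_potential_map_le (K : realFieldType) (x : K) : 2%:R * x + 1 != 0 ->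
  0 <= rb_potential x -> rb_potential (rb_map x) <= rb_potential x.
Proof.
move=> x0 q0; have d0 := rb_potential_denom_gt0 x0.
rewrite -(ler_pM2r d0) rb_potential_map //; nra.
Qed.

Lemma iter_rb_map_periodic (K : realFieldType) (x : K) (p m : nat) :
  2%:R * x + 1 != 0 -> (0 < p < m)%N ->
  iter p (@rb_map K) x = iter m (@rb_map K) x -> x = -1 \/ x = 0.
Proof.
move=> x0 /andP[p0 pm] xpm; apply: rb_potential_eq0.
pose q k := rb_potential (iter k (@rb_map K) x).
have y0 k : 2%:R * iter k (@rb_map K) x + 1 != 0 by exact: iter_rb_map_pole_free.
have qS k : q k.+1 * (1 + 4%:R * q k) = q k ^+ 2 := rb_potential_map (y0 k).
have q_ge0 k : 0 <= q k.+1 := rb_potential_map_ge0 (y0 k).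
have q_le k l : (0 < k)%N -> q (k + l)%N <= q k.
  case: k => // k _; elim: l => [|l IH]; first by rewrite addn0.
  apply: le_trans IH; rewrite addnS.
  exact: (rb_potential_map_le (y0 (k.+1 + l)%N) (q_ge0 (k + l)%N)).
(* the potential takes the same value at times p and m, hence also at p + 1 *)
have qp0 : q p = 0.
  have qm : q m <= q p.+1 by rewrite -(subnKC pm); exact: q_le.
  have {qm} : q p <= q p.+1 by rewrite {1}/q xpm.
  have := qS p; case: p p0 {pm xpm} => // p _; have := q_ge0 p.
  move: (q p.+1) (q p.+2) => a b a0 ab leab.
  have : a + 4%:R * a ^+ 2 <= a ^+ 2 by rewrite -ab; nra.
  nra.
elim: p qp0 {p0 pm xpm} => // p IH qp0; apply: IH.
by have /eqP := qS p; rewrite qp0 mul0r eq_sym sqrf_eq0 => /eqP.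
Qed.

(** * The quadratic system satisfied by the coefficients *)

Definition square_system (K : fieldType) (n : nat) (A C : 'M[K]_n) : Prop :=
  forall i j : 'I_n, \sum_k C i k ^+ 2 * A k j =
    (2%:R * C i i + 1) * \sum_k A i k * C k j.

Lemma square_system_triangular (K : fieldType) (n : nat) (A C : 'M[K]_n.+1) :
  normal_form A -> square_system A C ->
  forall i j : 'I_n.+1, (j < i)%N -> C i j = 0.
Proof.
move=> [A0 A1 _] CS i; have [d] := ubnP (n - i)%N.
elim: d i => // d IHd i lei j; have [m] := ubnP (j : nat).
elim: m j => // m IHm j lejm ltji.
have ltjn : (j.+1 < n.+1)%N by have := ltn_ord i; lia.
have := CS i (Ordinal ltjn); rewrite (bigD1 j) //= (A1 j) // mulr1.
rewrite big1 => [|k nkj]; last first.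
  have [ltjk|lekj] := ltnP j k; first by rewrite (A0 k) //= mulr0.
  have ltkj : (k < j)%N by rewrite ltn_neqAle lekj andbT.
  by rewrite (IHm k) ?expr0n ?mul0r //; lia.
rewrite addr0 => Csq; apply/eqP; rewrite -sqrf_eq0 Csq; apply/eqP.
rewrite big1 ?mulr0 // => k _.
have [leki|ltik] := leqP k i; first by rewrite A0 ?mul0r.
by rewrite (IHd k) ?mulr0 //=; have := ltn_ord k; lia.
Qed.

(** Squares of the entries in the last column do not show in the system, since
    the last row of [A] is zero: the left-hand side reduces to the diagonal. *)
Lemma square_system_row (K : fieldType) (n : nat) (A C : 'M[K]_n.+1) :
  normal_form A -> square_system A C ->
  (forall i j : 'I_n.+1, i != j -> (j < n)%N -> C i j = 0) ->
  forall i j : 'I_n.+1,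
    C i i ^+ 2 * A i j = (2%:R * C i i + 1) * \sum_k A i k * C k j.
Proof.
move=> [A0 _ _] CS C0 i j; rewrite -CS (bigD1 i) //= big1 ?addr0 // => k nki.
have [ltkn|lenk] := ltnP k n; first by rewrite C0 ?expr0n ?mul0r // eq_sym.
by rewrite (A0 k) ?mulr0 //; have := ltn_ord j; lia.
Qed.

Lemma square_system_last_column (K : fieldType) (n : nat) (A C : 'M[K]_n.+1) :
  normal_form A -> square_system A C ->
  (forall i j : 'I_n.+1, i != j -> (j < n)%N -> C i j = 0) ->
  forall i : 'I_n.+1, (0 < i < n)%N -> C i ord_max = 0.
Proof.
move=> nfA CS C0 i; have rowE := square_system_row nfA CS C0.
move: nfA => [A0 A1 An]; have [d] := ubnP (n - i)%N.
elim: d i => // d IHd i lei /andP[i0 ltin].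
have lti' : (i.-1 < n.+1)%N by lia.
pose i' := Ordinal lti'; have Ai'i : A i' i = 1 by apply: A1 => /=; lia.
have nz : 2%:R * C i' i' + 1 != 0.
  have := rowE i' i; rewrite Ai'i mulr1.
  by case/rb_map_unique.
have := rowE i' ord_max; rewrite An /=; last lia.
rewrite mulr0 => /esym/eqP; rewrite mulf_eq0 (negPf nz) /= => /eqP.
rewrite (bigD1 i) //= Ai'i mul1r big1 ?addr0 // => k nki.
have [leki|ltik] := leqP k i.
  rewrite A0 ?mul0r //=; move: nki; rewrite -val_eqE /=; lia.
have [ltkn|lenk] := ltnP k n; first by rewrite IHd ?mulr0 //; lia.
suff -> : k = ord_max by rewrite An ?mul0r //=; lia.
by apply: val_inj => /=; have := ltn_ord k; lia.
Qed.

Definition diagonal_relations (K : fieldType) (n : nat) (A : 'M[K]_n)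
    (r : nat -> K) : Prop :=
  forall i j : 'I_n, r i ^+ 2 * A i j = (2%:R * r i + 1) * (A i j * r j).

Lemma square_system_diagonal (K : fieldType) (n : nat) (A C : 'M[K]_n.+1) :
  normal_form A -> square_system A C ->
  (forall i j : 'I_n.+1, i != j -> (j < n)%N -> C i j = 0) ->
  diagonal_relations A (fun k => C (inord k) (inord k)).
Proof.
move=> nfA CS C0 i j; rewrite !inord_val (square_system_row nfA CS C0).
congr (_ * _); rewrite (bigD1 j) //= big1 ?addr0 // => k nkj.
have [ltjn|lenj] := ltnP j n; first by rewrite (C0 k j) ?mulr0.
have jE : j = ord_max by apply: val_inj => /=; have := ltn_ord j; lia.
have [A0 _ _] := nfA; case: (posnP k) => [k0|k_gt0]; first by rewrite A0 ?k0 ?mul0r.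
rewrite jE (square_system_last_column nfA CS C0) ?mulr0 // k_gt0 /=.
by move: nkj; rewrite jE -val_eqE /=; have := ltn_ord k; lia.
Qed.

(** * Rota-Baxter operators in coordinates *)

Lemma basis_coordE (K : fieldType) (E : vectType K) (n : nat) (e : n.-tuple E)
    (x : E) : basis_of fullv e -> x = \sum_k coord e k x *: e`_k.
Proof. by move=> eB; apply: (coord_basis eB); rewrite memvf. Qed.

Lemma coord_evolution_mul (K : fieldType) (E : vectType K) (n : nat)
    (mul : {bilinear E -> E -> E}) (e : n.-tuple E) (A : 'M[K]_n)
    (x y : E) (j : 'I_n) :
  is_evolution_algebra mul e A ->
  coord e j (mul x y) = \sum_k coord e k x * coord e k y * A k j.
Proof.
move=> [eB e0 eA]; have eF := basis_free eB.
rewrite {1}(basis_coordE x eB) linear_sumlz linear_sum; apply: eq_bigr => k _.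
rewrite linearZl_LR linearZ /= -mulrA; congr (_ * _).
rewrite {1}(basis_coordE y eB) linear_sumr linear_sum (bigD1 k) //= big1.
  by rewrite addr0 linearZr_LR linearZ /= eA coord_sum_free.
by move=> l nlk; rewrite linearZr_LR e0 1?eq_sym // scaler0 linear0.
Qed.

Lemma coord_endo (K : fieldType) (E : vectType K) (n : nat) (e : n.-tuple E)
    (R : 'End(E)) (x : E) (j : 'I_n) : basis_of fullv e ->
  coord e j (R x) = \sum_k coord e k x * coord e j (R e`_k).
Proof.
move=> eB; rewrite {1}(basis_coordE x eB) !linear_sum.
by apply: eq_bigr => k _; rewrite !linearZ.
Qed.

Lemma rota_baxter_square_system (K : fieldType) (E : vectType K) (n : nat)
    (mul : {bilinear E -> E -> E}) (e : n.-tuple E) (A : 'M[K]_n)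
    (R : 'End(E)) :
  is_evolution_algebra mul e A -> rota_baxter1 mul R ->
  square_system A (\matrix_(i, j) coord e j (R e`_i)).
Proof.
move=> hE RB i j; have [eB _ _] := hE; have eF := basis_free eB.
have /(congr1 (coord e j)) := RB e`_i e`_i.
rewrite (coord_evolution_mul _ _ _ hE) (coord_endo _ _ _ eB) => RBe.
rewrite (eq_bigr (fun k => coord e k (R e`_i) * coord e k (R e`_i) * A k j));
  last by move=> k _; rewrite !mxE expr2.
rewrite RBe mulr_sumr; apply: eq_bigr => k _; rewrite !mxE mulrA; congr (_ * _).
rewrite !linearD /= !(coord_evolution_mul _ _ _ hE) -!big_split /=.
rewrite (bigD1 i) //= big1 => [|l nli].
  by rewrite coord_free // eqxx mulr1n; ring.
by rewrite coord_free // eq_sym (negPf nli) mulr0n; ring.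
Qed.

(** Necessity is the analysis of the quadratic system. Sufficiency holds because
    products ignore the last coordinate and have none along [e_0], so that [R]
    acts diagonally both on the factors that count and on every product. *)
Lemma RB1_triP (K : fieldType) (E : vectType K) (n : nat)
    (mul : {bilinear E -> E -> E}) (e : n.+1.-tuple E) (A : 'M[K]_n.+1)
    (R : 'End(E)) :
  is_evolution_algebra mul e A -> normal_form A ->
  RB1_tri mul e R <-> exists (r : nat -> K) (beta : K),
    [/\ diagonal_relations A r,
        R e`_0 = r 0%N *: e`_0 + beta *: e`_n
      & forall i : 'I_n.+1, (0 < i)%N -> R e`_i = r i *: e`_i].
Proof.
move=> hE nfA; have [eB _ _] := hE; have eF := basis_free eB.
pose C : 'M[K]_n.+1 := \matrix_(i, j) coord e j (R e`_i).
split=> [[RB tri]|[r [beta [rel R0 RS]]]].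
  have CS : square_system A C := rota_baxter_square_system hE RB.
  have low := square_system_triangular nfA CS.
  have C0 (i j : 'I_n.+1) : i != j -> (j < n)%N -> C i j = 0.
    rewrite -val_eqE neq_ltn => /orP[ltij|/low] // ltjn.
    by rewrite mxE tri // ltij.
  exists (fun k => C (inord k) (inord k)).
  (* in dimension one the last column is the diagonal, already accounted for *)
  exists (if n == 0%N then 0 else C ord0 ord_max); split.
  - exact: square_system_diagonal.
  - rewrite (_ : inord 0 = ord0); last by apply: val_inj; rewrite /= inordK.
    rewrite (basis_coordE (R e`_0) eB) (bigD1 ord0) //= mxE; congr (_ + _).
    case: (n =P 0%N) => [n0|/eqP n0].
      rewrite scale0r big1 // => k; rewrite -val_eqE /=.
      by have := ltn_ord k; lia.
    rewrite (bigD1 ord_max) /=; last by rewrite -val_eqE /=.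
    rewrite big1 ?addr0 ?mxE // => k /andP[k0]; rewrite -val_eqE /= => kn.
    have := C0 ord0 k; rewrite mxE /= => ->; rewrite ?scale0r // 1?eq_sym //.
    by have := ltn_ord k; lia.
  - move=> i i0; rewrite inord_val (basis_coordE (R e`_i) eB) (bigD1 i) //=.
    rewrite mxE big1 ?addr0 // => k nki.
    suff: C i k = 0 by rewrite mxE => ->; rewrite scale0r.
    have [ltkn|lenk] := ltnP k n; first by rewrite C0 // eq_sym.
    have kE : k = ord_max by apply: val_inj => /=; have := ltn_ord k; lia.
    rewrite kE; apply: (square_system_last_column nfA CS C0); rewrite i0 /=.
    by move: nki; rewrite kE -val_eqE /=; have := ltn_ord i; lia.
have [A0 _ _] := nfA.
have An (k : 'I_n.+1) j : (n <= k)%N -> A k j = 0.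
  by move=> lenk; rewrite A0 //; have := ltn_ord j; lia.
have eE (i j : 'I_n.+1) : coord e j e`_i = (i == j)%:R by rewrite coord_free.
have C0 (i j : 'I_n.+1) : (j < n)%N -> coord e j (R e`_i) = r i * (i == j)%:R.
  move=> ltjn; case: (posnP i) => [i0|/RS->]; last by rewrite linearZ /= eE.
  have -> : i = ord0 by exact: val_inj.
  rewrite R0 linearD !linearZ /= (eE ord0 j) (eE ord_max j) -[ord_max == j]val_eqE.
  by rewrite gtn_eqF ?mulr0 ?addr0.
have coordR (x : E) (j : 'I_n.+1) : (j < n)%N -> coord e j (R x) = r j * coord e j x.
  move=> ltjn; rewrite (coord_endo _ _ _ eB) (bigD1 j) //= big1 => [|k nkj].
    by rewrite C0 // eqxx addr0 mulr1 mulrC.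
  by rewrite C0 // (negPf nkj) !mulr0.
split; last first.
  by move=> i j /andP[ltij ltjn]; rewrite C0 // -val_eqE ltn_eqF ?mulr0.
move=> x y; rewrite (basis_coordE (mul _ _) eB) [RHS](basis_coordE _ eB).
apply: eq_bigr => j _; congr (_ *: _).
rewrite (coord_endo _ _ _ eB).
set v := mul (R x) y + mul x (R y) + mul x y.
have vE l : coord e l v =
    \sum_(k < n.+1) (2%:R * r k + 1) * (coord e k x * coord e k y * A k l).
  rewrite !linearD /= !(coord_evolution_mul _ _ _ hE) -!big_split /=.
  apply: eq_bigr => k _; have [ltkn|lenk] := ltnP k n.
    by rewrite !coordR //; ring.
  by rewrite !An // !mulr0 !addr0.
(* products lie in the span of e_1, ..., e_n, where R is diagonal *)
have -> : \sum_k coord e k v * coord e j (R e`_k) = coord e j v * r j.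
  have v0 : coord e ord0 v = 0.
    by rewrite vE big1 // => k _; rewrite (A0 k) // !mulr0.
  rewrite (bigD1 j) //= big1 ?addr0 => [|k nkj].
    case: (posnP j) => [j0|/RS->]; last by rewrite linearZ /= eE eqxx mulr1.
    by have -> : j = ord0 by [exact: val_inj]; rewrite v0 !mul0r.
  case: (posnP k) => [k0|/RS->].
    by have -> : k = ord0 by [exact: val_inj]; rewrite v0 mul0r.
  by rewrite linearZ /= eE (negPf nkj) !mulr0.
rewrite (coord_evolution_mul _ _ _ hE) vE mulr_suml; apply: eq_bigr => k _.
have [ltkn|lenk] := ltnP k n; last by rewrite !An // !mulr0 mul0r.
rewrite !coordR //; have := rel k j; move: (A k j) (r k) (r j) => a s t ast.
transitivity (coord e k x * coord e k y * (s ^+ 2 * a)); first by ring.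
by rewrite ast; ring.
Qed.

(** The superdiagonal ones of a normal form make the diagonal an orbit. *)
Lemma diagonal_relations_iter (K : fieldType) (n : nat) (A : 'M[K]_n.+1)
    (r : nat -> K) : normal_form A -> diagonal_relations A r ->
  forall k, (k <= n)%N -> r k = iter k (@rb_map K) (r 0%N).
Proof.
move=> [_ A1 _] rel; elim=> // k IH ltkn /=; rewrite -IH; last exact: ltnW.
have ltk : (k < n.+1)%N by exact: ltnW.
have := rel (Ordinal ltk) (Ordinal (ltkn : (k.+1 < n.+1)%N)).
by rewrite A1 //= mulr1 mul1r => /rb_map_unique[].
Qed.

Lemma diagonal_relations_pole_free (K : fieldType) (n : nat) (A : 'M[K]_n.+1)
    (r : nat -> K) : normal_form A -> diagonal_relations A r -> (0 < n)%N ->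
  2%:R * r 0%N + 1 != 0.
Proof.
move=> [_ A1 _] rel n0.
have := rel ord0 (Ordinal (n0 : (1 < n.+1)%N)).
by rewrite A1 //= mulr1 mul1r => /rb_map_unique[].
Qed.

Lemma I_set0_relations (K : realFieldType) (n : nat) (A : 'M[K]_n.+1)
    (x : K) : normal_form A -> I_set A = finset.set0 -> 2%:R * x + 1 != 0 ->
  diagonal_relations A (fun k => iter k (@rb_map K) x).
Proof.
move=> [A0 A1 An] I0 x0 i j; have y0 := iter_rb_map_pole_free i x0.
case: (ltngtP j i.+1) => [leji|ltij|jE].
- by rewrite A0 // !(mulr0, mul0r).
- suff -> : A i j = 0 by rewrite !(mulr0, mul0r).
  have [ltjn|lenj] := ltnP j n.
    apply/eqP; apply: contraT => Aij.
    have : (i, j) \in I_set A by rewrite inE /= ltij ltjn Aij.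
    by rewrite I0 finset.in_set0.
  have -> : j = ord_max by apply: val_inj => /=; have := ltn_ord j; lia.
  by apply: An; have := ltn_ord j; lia.
- by rewrite A1 // jE mulr1 mul1r /= {2}/rb_map mulrCA mulfV ?mulr1.
Qed.

Lemma I_set_relations (K : realFieldType) (n : nat) (A : 'M[K]_n.+1)
    (r : nat -> K) : normal_form A -> I_set A <> finset.set0 ->
  diagonal_relations A r -> r 0%N = -1 \/ r 0%N = 0.
Proof.
move=> nfA /eqP/set0Pn[[i j]]; rewrite inE /= => /and3P[ltij ltjn Aij] rel.
have n0 : (0 < n)%N by exact: leq_ltn_trans ltjn.
have x0 := diagonal_relations_pole_free nfA rel n0.
have it := diagonal_relations_iter nfA rel.
apply: (@iter_rb_map_periodic _ _ i.+1 j) => //.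
rewrite -!it ?(ltnW ltjn) //; last by lia.
rewrite [RHS](@rb_map_unique _ (r i) (r j) _).2.
  by rewrite it /=; [rewrite -it //; lia | lia].
by apply: (mulIf Aij); rewrite rel; ring.
Qed.

Theorem theorem5p3 (K : realType) (E : vectType K) (n : nat)
    (mul : {bilinear E -> E -> E}) (e : n.+1.-tuple E) (A : 'M[K]_n.+1)
    (hE : is_evolution_algebra mul e A) (hA : normal_form A) :
  (I_set A = finset.set0 ->
    RB1_tri mul e =
    [set R : 'End(E) | exists alpha beta : K,
       [/\ alpha <> - (1 / 2%:R),
           R e`_0 = alpha *: e`_0 + beta *: e`_n
         & forall i : 'I_n.+1, (0 < i)%N ->
             R e`_i = iter i (@rb_map K) alpha *: e`_i]]%classic)
  /\
  (I_set A <> finset.set0 ->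
    RB1_tri mul e =
    [set R : 'End(E) | exists alpha beta : K,
       [/\ alpha = -1 \/ alpha = 0,
           R e`_0 = alpha *: e`_0 + beta *: e`_n
         & forall i : 'I_n.+1, (0 < i)%N ->
             R e`_i = alpha *: e`_i]]%classic).
Proof.
have pole (x : K) : 2%:R * x + 1 != 0 <-> x <> - (1 / 2%:R).
  by split=> [/eqP + xE|+]; [apply; lra | move=> xN; apply/eqP => x0; apply: xN; lra].
split=> hI; apply/seteqP; split=> R.
- move/(RB1_triP R hE hA) => [r [beta [rel R0 RS]]].
  (* in dimension one r_0 may be the pole: absorb it into beta *)
  case: (posnP n) => [n0|n0].
    exists 0, (r 0%N + beta); split; first by lra.
      have en : e`_n = e`_0 by congr (nth 0 e _).
      by rewrite R0 en scale0r add0r scalerDl.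
    by move=> i; have := ltn_ord i; lia.
  exists (r 0%N), beta; split=> //.
    exact/pole/(diagonal_relations_pole_free hA rel).
  by move=> i /RS->; rewrite (diagonal_relations_iter hA rel) // -ltnS.
- move=> [alpha [beta [/pole a0 R0 RS]]]; apply/(RB1_triP R hE hA).
  exists (fun k => iter k (@rb_map K) alpha), beta; split=> //.
  exact: I_set0_relations.
- move/(RB1_triP R hE hA) => [r [beta [rel R0 RS]]].
  have r0 := I_set_relations hA hI rel.
  exists (r 0%N), beta; split=> // i /RS->.
  rewrite (diagonal_relations_iter hA rel) -1?ltnS //.
  by rewrite iter_fix // rb_map_fixed.
- move=> [alpha [beta [a0 R0 RS]]]; apply/(RB1_triP R hE hA).
  exists (fun=> alpha), beta; split=> // i j.
  by case: a0 => ->; ring.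
Qed.
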